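(* Let $G$ be a finite partial cube with the opposite-semicube Helly property. Then $G$ is antipodal if and only if $G$ is opposite-semicube-isomorphic.
   Context: All graphs are undirected, connected, simple and finite; $d_G$ is the usual shortest-path distance. A partial cube is a graph isomorphic to an isometric subgraph of some hypercube (a subgraph $H$ of $Q$ is isometric if $d_H(x,y)=d_Q(x,y)$ for all $x,y\in V(H)$). The Djokovi\'c–Winkler relation on $E(G)$ is: $uv\,\Theta\,xy$ iff $d_G(u,x)+d_G(v,y)\ne d_G(u,y)+d_G(v,x)$; in a partial cube it is an equivalence relation, and its classes $E_1,\dots,E_d$ are the $\Theta$-classes. For a $\Theta$-class $E_i$ and an edge $xy\in E_i$, the two (opposite) semicubes associated with $E_i$ are $W_i^0=\{a\in V(G): d_G(x,a)<d_G(y,a)\}$ and $W_i^1=\{a\in V(G): d_G(y,a)<d_G(x,a)\}$ (independent of the choice of $xy\in E_i$ up to interchanging the labels $0,1$; they partition $V(G)$). For $x\in V(G)$, $W_i(x)$ denotes the one of $W_i^0,W_i^1$ containing $x$, and $W_i^*(x)$ the other one. $G$ is opposite-semicube-isomorphic if $G[W_i^0]\cong G[W_i^1]$ (induced subgraphs) for every $i\in\{1,\dots,d\}$. $G$ has the opposite-semicube Helly property if for every $x\in V(G)$: whenever $W_i^*(x)\cap W_j^*(x)\ne\emptyset$ for all $1\le i,j\le d$ with $i\ne j$, we have $\bigcap_{i=1}^d W_i^*(x)\ne\emptyset$. A vertex $y$ is a relative antipode of $x$ in $G$ if $d_G(x,y)\ge d_G(x,z)$ for every neighbor $z$ of $y$.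 $G$ is antipodal if every vertex has exactly one relative antipode. *)

(* Defs.v *)
From mathcomp Require Import all_boot.

Set Implicit Arguments.
Unset Strict Implicit.
Unset Printing Implicit Defensive.

Record sgraph := SGraph {
  svertex :> finType;
  sedge : rel svertex;
  sg_sym : symmetric sedge;
  sg_irrefl : irreflexive sedge }.

Notation "x -- y" := (sedge x y) (at level 30).

Definition connected (G : sgraph) : Prop :=
  forall x y : G, connect (@sedge G) x y.

Definition walk_of_length (G : sgraph) (x y : G) (k : nat) : bool :=
  [exists p : k.-tuple G, path (@sedge G) x p && (last x p == y)].

(* Shortest walks have length < #|G|, so #|G| is returned exactly when y is
   not reachable from x. *)
Definition dist (G : sgraph) (x y : G) : nat :=
  find (walk_of_length x y) (iota 0 #|G|).

Definition isomorphic (G H : sgraph) : Prop :=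
  exists f : G -> H, bijective f /\ forall x y, (f x -- f y) = (x -- y).

Section Induced.
Variables (G : sgraph) (A : {set G}).

Definition induced_edge : rel {x : G | x \in A} :=
  fun x y => val x -- val y.

Lemma induced_sym : symmetric induced_edge.
Proof. by move=> x y; apply: sg_sym. Qed.

Lemma induced_irrefl : irreflexive induced_edge.
Proof. by move=> x; apply: sg_irrefl. Qed.

Definition induced : sgraph := SGraph induced_sym induced_irrefl.

End Induced.

(* Not necessarily induced. *)
Record subgraph (G : sgraph) := Subgraph {
  sub_vertices : {set G};
  sub_edge : rel G;
  sub_edge_sym : symmetric sub_edge;
  sub_edgeP : forall x y, sub_edge x y ->
    [&& x \in sub_vertices, y \in sub_vertices & x -- y] }.

Section GraphOfSubgraph.
Variables (G : sgraph) (H : subgraph G).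

Definition subgraph_edge : rel {x : G | x \in sub_vertices H} :=
  fun x y => sub_edge H (val x) (val y).

Lemma subgraph_sym : symmetric subgraph_edge.
Proof. by move=> x y; apply: sub_edge_sym. Qed.

Lemma subgraph_irrefl : irreflexive subgraph_edge.
Proof.
move=> x; apply/negbTE/negP => /sub_edgeP /and3P[_ _].
by rewrite sg_irrefl.
Qed.

Definition graph_of_subgraph : sgraph := SGraph subgraph_sym subgraph_irrefl.

End GraphOfSubgraph.

(* Connectedness is required so that the value of [dist] on unreachable pairs
   plays no role. *)
Definition isometric (G : sgraph) (H : subgraph G) : Prop :=
  connected (graph_of_subgraph H) /\
  forall x y : graph_of_subgraph H, dist x y = dist (val x) (val y).

Section Hypercube.
Variable n : nat.

Definition hypercube_edge : rel {ffun 'I_n -> bool} :=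
  fun u v => #|[set i | u i != v i]| == 1.

Lemma hypercube_sym : symmetric hypercube_edge.
Proof.
by move=> u v; congr (#|pred_of_set _| == 1); apply/setP=> i; rewrite !inE eq_sym.
Qed.

Lemma hypercube_irrefl : irreflexive hypercube_edge.
Proof.
move=> u; rewrite /hypercube_edge (_ : [set _ | _] = set0) ?cards0 //.
by apply/setP=> i; rewrite !inE eqxx.
Qed.

Definition hypercube : sgraph := SGraph hypercube_sym hypercube_irrefl.

End Hypercube.

Definition partial_cube (G : sgraph) : Prop :=
  exists (n : nat) (H : subgraph (hypercube n)),
    isometric H /\ isomorphic G (graph_of_subgraph H).

Section Semicubes.
Variable G : sgraph.

(* An undirected edge xy is represented by its two orientations (x, y) and
   (y, x).  These are always related by [theta], whose value moreover does not
   depend on the orientations of its arguments, so the classes of oriented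
   edges correspond one-to-one to those of undirected edges. *)
Definition edges : {set G * G} := [set p | p.1 -- p.2].

Definition theta : rel (G * G) := fun p q =>
  dist p.1 q.1 + dist p.2 q.2 != dist p.1 q.2 + dist p.2 q.1.

Definition theta_classes : {set {set G * G}} :=
  equivalence_partition theta edges.

Definition semicube (x y : G) : {set G} := [set a | dist x a < dist y a].

(* The semicube W_C^*(x) not containing x.  In a partial cube all the members of
   this union coincide, because the pair of semicubes does not depend on the
   choice of an edge in C; the union is nonempty since C contains both
   orientations of each of its edges. *)
Definition opp_semicube (C : {set G * G}) (x : G) : {set G} :=
  \bigcup_(p in C | x \in semicube p.1 p.2) semicube p.2 p.1.

Definition opposite_semicube_isomorphic : Prop :=
  forall C, C \in theta_classes -> forall x y, (x, y) \in C ->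
    isomorphic (induced (semicube x y)) (induced (semicube y x)).

Definition opposite_semicube_Helly : Prop :=
  forall x : G,
    (forall C D, C \in theta_classes -> D \in theta_classes -> C != D ->
       opp_semicube C x :&: opp_semicube D x != set0) ->
    \bigcap_(C in theta_classes) opp_semicube C x != set0.

Definition relative_antipode (x y : G) : Prop :=
  forall z, y -- z -> dist x z <= dist x y.

Definition antipodal : Prop :=
  forall x : G, exists! y, relative_antipode x y.

End Semicubes.

(* Main.v *)
Require Import Defs.
From mathcomp Require Import all_boot zify.

(** Forward: every geodesic from [x] extends to one ending at a relative
    antipode, so in an antipodal graph every vertex lies on a geodesic from [x]
    to its antipode [x']. By additivity of distances along these geodesics
    [x |-> x'] is an isometric involution, and it exchanges the semicubes of
    each edge. This half needs neither the cube structure nor the Helly property.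

    Backward: opposite semicubes have the same size, namely half the vertices.
    If the semicubes of two classes opposite to [x] were disjoint, one would be
    the complement of the other, although [x] lies in that complement. So the
    Helly property yields a vertex [y] separated from [x] by every class. Moving
    along an edge then brings one closer to [y] exactly when it takes one away
    from [x], so [y] is the only relative antipode of [x]. *)

Set Implicit Arguments.
Unset Strict Implicit.
Unset Printing Implicit Defensive.

(** * Walks and the distance *)

Lemma walkP (G : sgraph) (x y : G) k :
  reflect (exists2 p, path (@sedge G) x p & last x p = y /\ size p = k)
          (walk_of_length x y k).
Proof.
apply: (iffP existsP) => [[p /andP[xp /eqP yp]]|[p xp [yp /eqP sp]]].
  by exists p => //; rewrite size_tuple.
by exists (Tuple sp); rewrite /= xp yp eqxx.
Qed.

Lemma dist_le (G : sgraph) (x y : G) k : walk_of_length x y k -> dist x y <= k.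
Proof.
move=> xyk; rewrite leqNgt; apply/negP => lt_k.
have kG : k < #|G|.
  by apply: leq_trans lt_k _; rewrite -[X in _ <= X](size_iota 0) find_size.
by have := before_find 0 lt_k; rewrite nth_iota // xyk.
Qed.

(** [dist] searches only lengths below [#|G|]; a path without repeated vertices has its length in
    that range. *)
Lemma dist_walk (G : sgraph) (x y : G) :
  connect (@sedge G) x y -> walk_of_length x y (dist x y).
Proof.
move=> /connectP[p0 xp0 ->]; case/shortenP: xp0 => p xp up _.
set y' := last x p.
have lt_p : size p < #|G|.
  by have := max_card (mem (x :: p)); rewrite (card_uniqP up).
have hasw : has (walk_of_length x y') (iota 0 #|G|).
  by apply/hasP; exists (size p); [rewrite mem_iota | apply/walkP; exists p].
have := nth_find 0 hasw; rewrite nth_iota //.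
by rewrite -[X in _ < X](size_iota 0) -has_find.
Qed.

Lemma dist_isomorphism (G H : sgraph) (f : G -> H) :
  bijective f -> (forall x y, (f x -- f y) = (x -- y)) ->
  forall x y, dist (f x) (f y) = dist x y.
Proof.
move=> bij_f edge_f x y; rewrite /dist (bij_eq_card bij_f).
have [g fK gK] := bij_f.
apply: eq_find => k; apply/walkP/walkP => [[p xp [yp sp]]|[p xp [yp sp]]].
  have pE : map f (map g p) = p by rewrite mapK.
  exists (map g p); last first.
    by rewrite size_map; split=> //; apply: (can_inj fK); rewrite -last_map pE.
  move: xp; rewrite -pE path_map pE.
  by apply: sub_path => u v; rewrite /relpre /= edge_f.
exists (map f p); last by rewrite last_map yp size_map.
by rewrite path_map; move: xp; apply: sub_path => u v; rewrite /relpre /= edge_f.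
Qed.

Section Metric.
Variables (G : sgraph) (connG : connected G).
Implicit Types x y z : G.

Lemma dist_xx x : dist x x = 0.
Proof. by apply/eqP; rewrite -leqn0; apply: dist_le; apply/walkP; exists [::]. Qed.

Lemma dist_eq0 x y : dist x y = 0 -> x = y.
Proof.
by move=> d0; have := dist_walk (connG x y); rewrite d0 => /walkP[[|? ?] _ []].
Qed.

Lemma dist_triangle x y z : dist x z <= dist x y + dist y z.
Proof.
have /walkP[p xp [yp sp]] := dist_walk (connG x y).
have /walkP[q yq [zq sq]] := dist_walk (connG y z).
apply: dist_le; apply/walkP; exists (p ++ q).
  by rewrite cat_path xp yp.
by rewrite last_cat size_cat yp zq sp sq.
Qed.

Lemma dist_sym_le x y : dist y x <= dist x y.
Proof.
have /walkP[p xp [yp sp]] := dist_walk (connG x y).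
apply: dist_le; apply/walkP; exists (rev (belast x p)).
  rewrite -yp rev_path; move: xp; apply: sub_path => u v.
  by rewrite /= sg_sym.
rewrite size_rev size_belast sp; split=> //.
by case: p yp {xp sp} => [|a p] //= _; rewrite rev_cons last_rcons.
Qed.

Lemma dist_sym x y : dist x y = dist y x.
Proof. by apply/eqP; rewrite eqn_leq !dist_sym_le. Qed.

Lemma edge_dist x y : (x -- y) = (dist x y == 1).
Proof.
apply/idP/eqP => [xy|d1].
  apply/eqP; rewrite eqn_leq; apply/andP; split.
    by apply: dist_le; apply/walkP; exists [:: y] => //=; rewrite xy.
  rewrite lt0n; apply: contraTneq xy => /dist_eq0 ->.
  by rewrite sg_irrefl.
have := dist_walk (connG x y); rewrite d1.
by case/walkP => [[|z [|? ?]]] /= xz [<-] // _; case/andP: xz.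
Qed.

Lemma closer_neighbor x y : x != y -> exists2 z, x -- z & dist z y < dist x y.
Proof.
move=> xy; have /walkP[[|z p] xp [yp sp]] := dist_walk (connG x y).
  by rewrite /= in yp; rewrite yp eqxx in xy.
case/andP: xp => xz zp; exists z => //; rewrite -sp /= ltnS.
by apply: dist_le; apply/walkP; exists p.
Qed.

End Metric.

(** * From antipodality to isomorphic opposite semicubes *)

Lemma antipodal_bijection_semicube (G : sgraph) (bar : G -> G) (u v : G) :
  involutive bar -> (forall a b, (bar a -- bar b) = (a -- b)) ->
  (forall x y a, (bar a \in semicube x y) = (a \in semicube y x)) ->
  isomorphic (induced (semicube u v)) (induced (semicube v u)).
Proof.
move=> barK edge_bar bar_semicube.
have swap x y (a : {a | a \in semicube x y}) : bar (val a) \in semicube y x.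
  by rewrite bar_semicube (valP a).
pose swap_bar x y (a : induced (semicube x y)) : induced (semicube y x) :=
  exist (fun b => b \in semicube y x) (bar (val a)) (swap x y a).
exists (swap_bar u v); split; last by move=> a b; apply: edge_bar.
by exists (swap_bar v u) => a; apply: val_inj; apply: barK.
Qed.

Section AntipodalIsomorphic.
Variables (G : sgraph) (connG : connected G) (antiG : antipodal G).

(** A [z] other than [y] is not a relative antipode of [x], so some neighbor [w] is farther from
    [x]. By induction [w] lies on a geodesic from [x] to [y], and the triangle inequality passes
    this on to [z]. *)
Lemma relative_antipode_geodesic (x y z : G) :
  relative_antipode x y -> dist x z + dist z y = dist x y.
Proof.
have [n] := ubnP (#|G| - dist x z).
(* This bound makes [#|G| - dist x z] drop strictly when [dist x z] grows. *)
have dist_max (a b : G) : dist a b <= #|G|.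
  by rewrite -[X in _ <= X](size_iota 0) find_size.
elim: n z => // n IHn z lt_n xy.
have [->|zy] := eqVneq z y; first by rewrite dist_xx addn0.
have [w zw xw] : exists2 w, z -- w & dist x z < dist x w.
  case: (pickP (fun w => (z -- w) && (dist x z < dist x w))) => [w /andP[]|no].
    by exists w.
  have xz : relative_antipode x z.
    by move=> w zw; rewrite leqNgt; have := no w; rewrite zw /= => ->.
  have [y' [_ uy']] := antiG x.
  by rewrite -(uy' _ xy) -(uy' _ xz) eqxx in zy.
have dw := dist_max x w.
have := IHn w; have := edge_dist connG z w; rewrite zw => /esym/eqP zw1.
have t1 := dist_triangle connG x z w; have t2 := dist_triangle connG z w y.
have t3 := dist_triangle connG x z y.
by move=> /(_ ltac:(lia) xy); lia.
Qed.

Lemma antipodal_isomorphic : opposite_semicube_isomorphic G.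
Proof.
have ex_bar x : exists y : G, [forall z, (y -- z) ==> (dist x z <= dist x y)].
  have [y [xy _]] := antiG x; exists y.
  by apply/forallP => z; apply/implyP; apply: xy.
pose bar x := xchoose (ex_bar x).
have barP x : relative_antipode x (bar x).
  move=> z; have /forallP/(_ z)/implyP := xchooseP (ex_bar x); exact.
have geod x z := relative_antipode_geodesic z (barP x).
have dS := dist_sym connG.
have barK : involutive bar.
  move=> a; have [y [_ uy]] := antiG (bar a).
  (* Each [z] lies on a geodesic between [a] and [bar a], so [a] is a relative antipode of
     [bar a]. *)
  rewrite -(uy _ (barP _)); apply: uy => z _.
  by rewrite -![dist (bar a) _]dS -(geod a z) leq_addl.
have dist_bar a b : dist (bar a) (bar b) = dist a b.
  (* The four equations express each of [dist a (bar a)] and [dist b (bar b)] in two ways; adding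
     the two resulting equalities cancels the mixed distances. *)
  have := geod a b; have := geod b a; have := geod a (bar b).
  have := geod b (bar a); rewrite (dS b a) (dS (bar b) (bar a)).
  lia.
move=> C _ u v _; apply: (antipodal_bijection_semicube (bar := bar)) => //.
  by move=> a b; rewrite !edge_dist // dist_bar.
(* Distances from any vertex to [a] and to [bar a] have the constant sum [dist a (bar a)], so
   comparisons reverse. *)
move=> x y a; rewrite !inE.
by have := geod a x; have := geod a y; rewrite !(dS a); lia.
Qed.

End AntipodalIsomorphic.

(** * Hypercube distance as Hamming distance *)

Section Hamming.
Variable n : nat.
Implicit Types u v w : {ffun 'I_n -> bool}.

Definition hamming u v := #|[set i | u i != v i]|.

Lemma hamming_triangle u v w : hamming u w <= hamming u v + hamming v w.
Proof.
apply: leq_trans (leq_card_setU _ _); apply/subset_leq_card/subsetP => i.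
by rewrite !inE; case: (u i) (v i) (w i) => [] [] [].
Qed.

(** Passing from [u] to [v] adds exactly [i] to the set of coordinates that differ from [w]. *)
Lemma hamming_flip u v w i :
  (forall j, (u j != v j) = (j == i)) -> w i = u i ->
  hamming v w = (hamming u w).+1.
Proof.
move=> uv wi; rewrite /hamming; have := uv i; rewrite eqxx => uvi.
rewrite -add1n; have <- : (i \notin [set j | u j != w j]) = 1 :> nat.
  by rewrite inE wi eqxx.
rewrite -cardsU1; congr #|pred_of_set _|; apply/setP => j; rewrite !inE.
have [->|ji] := eqVneq j i; first by rewrite wi eq_sym.
by have := uv j; rewrite (negbTE ji) => /negbFE/eqP ->.
Qed.

Lemma hypercube_walk_hamming (u v : hypercube n) :
  walk_of_length u v (hamming u v).
Proof.
move Ek: (hamming u v) => k; elim: k u Ek => [|k IHk] u Ek.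
  apply/walkP; exists [::] => //; split=> //=; apply/ffunP => i.
  move/eqP: Ek; rewrite cards_eq0 => /eqP/setP/(_ i).
  by rewrite !inE => /negbFE/eqP.
have /card_gt0P[i] : 0 < hamming u v by rewrite Ek.
rewrite inE => uvi.
(* One step from [u] towards [v]: a coordinate where they differ is corrected. *)
pose w : {ffun 'I_n -> bool} := [ffun j => if j == i then v j else u j].
have wu j : (w j != u j) = (j == i).
  by rewrite ffunE; case: (eqVneq j i) => [->|]; rewrite ?eqxx // eq_sym uvi.
have wi : v i = w i by rewrite ffunE eqxx.
have Ew : hamming w v = k by have := hamming_flip wu wi; rewrite Ek => -[].
have /walkP[p wp [vp sp]] := IHk w Ew.
apply/walkP; exists (w :: p) => /=; last by rewrite vp sp.
rewrite wp andbT /= /hypercube_edge; apply/eqP; rewrite -(cards1 i).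
by congr #|pred_of_set _|; apply/setP => j; rewrite !inE -wu eq_sym.
Qed.

Lemma hamming_path (u : hypercube n) p :
  path (@sedge (hypercube n)) u p -> hamming u (last u p) <= size p.
Proof.
elim: p u => [|w p IHp] u /=.
  by move=> _; rewrite leqn0 cards_eq0; apply/eqP/setP => i; rewrite !inE eqxx.
move=> /andP[/eqP uw /IHp wp]; apply: leq_trans (hamming_triangle u w _) _.
by rewrite {1}/hamming uw add1n ltnS.
Qed.

Lemma hypercube_dist (u v : hypercube n) : dist u v = hamming u v.
Proof.
have uv := hypercube_walk_hamming u v.
apply/eqP; rewrite eqn_leq dist_le //=.
(* The Hamming walk also supplies the reachability that [dist_walk] requires. *)
have /dist_walk/walkP[p up [<- <-]] : connect (@sedge (hypercube n)) u v.
  by have /walkP[p up [<- _]] := uv; apply/connectP; exists p.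
exact: hamming_path.
Qed.

End Hamming.

(** * Coordinates, theta-classes and semicubes of a partial cube *)

Lemma partial_cube_coordinates (G : sgraph) : partial_cube G ->
  exists n (f : G -> {ffun 'I_n -> bool}),
    forall x y, dist x y = hamming (f x) (f y).
Proof.
move=> [n [H [[_ isoH] [g [bij_g edge_g]]]]]; exists n, (fun x => val (g x)).
by move=> x y; rewrite -(dist_isomorphism bij_g edge_g) isoH -hypercube_dist.
Qed.

Section PartialCube.
Variables (G : sgraph) (connG : connected G) (pcG : partial_cube G).

(** [c] is the coordinate of the embedding that the edge [uv] flips. A vertex is closer by exactly
    one to the endpoint sharing its value of [c], so [c] decides both [theta] and the semicubes. *)
Lemma edge_coordinate (u v : G) : u -- v ->
  exists c : G -> bool, [/\ c u != c v,
    forall x y, theta (u, v) (x, y) = (c x != c y)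
    & forall x y, x -- y -> c x != c y ->
        semicube x y = [set a | c a == c x]].
Proof.
have [n [f distE]] := partial_cube_coordinates pcG.
have flip x y : x -- y -> exists i, forall j, (f x j != f y j) = (j == i).
  rewrite edge_dist // distE => /cards1P[i /setP xyi].
  by exists i => j; have := xyi j; rewrite !inE.
have closer x y i a : (forall j, (f x j != f y j) = (j == i)) ->
    f a i = f x i -> dist y a = (dist x a).+1.
  by move=> xy ax; rewrite !distE; apply: hamming_flip xy ax.
have farther x y i a : (forall j, (f x j != f y j) = (j == i)) ->
    f a i != f x i -> dist x a = (dist y a).+1.
  move=> xy ax; apply: (closer y x i) => [j|]; first by rewrite eq_sym xy.
  have := xy i; rewrite eqxx; move: ax.
  by case: (f a i) (f x i) (f y i) => [] [] [].
move=> /flip[i uv]; exists (fun a => f a i); split; first by rewrite uv.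
- move=> x y; rewrite /theta /=.
  have [xu|xu] := eqVneq (f x i) (f u i); have [yu|yu] := eqVneq (f y i) (f u i).
  (* When [x] and [y] are on the same side, the two sums in [theta] agree; otherwise they differ by
     2. *)
  + by rewrite xu yu eqxx !(closer u v i) //; lia.
  + by rewrite xu [_ == f y i]eq_sym yu (closer u v i x) // (farther u v i y) //; lia.
  + by rewrite yu xu (closer u v i y) // (farther u v i x) //; lia.
  + rewrite (farther u v i x) // (farther u v i y) //.
    have -> : f x i = f y i.
      by move: xu yu; case: (f x i) (f y i) (f u i) => [] [] [].
    by rewrite eqxx; lia.
(* An edge flips a single coordinate, so one that changes coordinate [i] flips only that one and
   splits the vertices as [uv] does. *)
- move=> x y /flip[j xy] xyi; have ij : i = j by apply/eqP; rewrite -xy.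
  apply/setP => a; rewrite !inE; rewrite -ij in xy.
  have [ax|ax] := eqVneq (f a i) (f x i).
    by rewrite (closer x y i) //; lia.
  by rewrite (farther x y i) //; lia.
Qed.

Lemma semicubeC (u v : G) : u -- v -> semicube v u = ~: semicube u v.
Proof.
move=> uv; have [c [cuv _ cE]] := edge_coordinate uv.
rewrite !cE // 1?sg_sym 1?eq_sym //; apply/setP => a; rewrite !inE.
by move: cuv; case: (c u) (c v) (c a) => [] [] [].
Qed.

Lemma edge_theta_class (u v : G) : u -- v ->
  [set q in edges G | theta (u, v) q] \in theta_classes G.
Proof. by move=> uv; apply/imsetP; exists (u, v); rewrite ?inE. Qed.

(** For every pair of the class oriented with [x] on its first side, the second semicube is the set
    where [c] differs from [c x]; all members of the union coincide. *)
Lemma opp_semicubeE (u v x : G) : u -- v -> x \in semicube u v ->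
  opp_semicube [set q in edges G | theta (u, v) q] x = semicube v u.
Proof.
move=> uv xu; have [c [cuv thetaE cE]] := edge_coordinate uv.
have cvu : c v != c u by rewrite eq_sym.
have memC p q : ((p, q) \in [set q in edges G | theta (u, v) q])
    = (p -- q) && (c p != c q).
  by rewrite !inE thetaE.
move: xu; rewrite (cE u v) // (cE v u) 1?sg_sym // inE => xu.
apply/setP => a; rewrite inE; apply/bigcupP/idP => [[[p q]]|av].
  rewrite memC /= => /andP[/andP[pq cpq]].
  rewrite (cE p q) // (cE q p) 1?sg_sym 1?eq_sym // !inE.
  move: cpq cuv xu.
  by case: (c p) (c q) (c u) (c v) (c x) (c a) => [] [] [] [] [] [].
by exists (u, v) => /=; rewrite ?memC ?cE ?inE ?uv ?cuv // sg_sym.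
Qed.

Lemma opp_semicube_theta_class (C : {set G * G}) (x : G) :
  C \in theta_classes G ->
  exists u v, [/\ (u, v) \in C, u -- v, x \in semicube u v
                & opp_semicube C x = semicube v u].
Proof.
case/imsetP=> -[u v]; rewrite inE /= => uv ->.
have [c [cuv thetaE cE]] := edge_coordinate uv.
have [xu|xu] := boolP (x \in semicube u v).
  by exists u, v; split; rewrite ?opp_semicubeE // !inE thetaE uv.
have vu : v -- u by rewrite sg_sym.
have xv : x \in semicube v u by rewrite semicubeC // inE.
(* With [x] on the side of [v] the edge is reversed; [theta] ignores orientation, so the class is
   the same. *)
exists v, u; split=> //; first by rewrite !inE thetaE vu eq_sym.
rewrite -(opp_semicubeE vu xv); congr opp_semicube; apply/setP => -[p q].
have [c' [_ thetaE' _]] := edge_coordinate vu.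
by rewrite !inE /theta /= [dist v p + _]addnC eq_sym [dist v q + _]addnC.
Qed.

Lemma theta_separated_edge (x y u v : G) :
  y \in \bigcap_(C in theta_classes G) opp_semicube C x -> u -- v ->
  (y \in semicube u v) = (x \in semicube v u).
Proof.
move=> /bigcapP xy uv; have vu : v -- u by rewrite sg_sym.
have [xu|xu] := boolP (x \in semicube v u).
  have := xy _ (edge_theta_class vu).
  by rewrite opp_semicubeE.
have {}xu : x \in semicube u v by rewrite semicubeC // inE.
have := xy _ (edge_theta_class uv).
by rewrite opp_semicubeE // semicubeC // inE => /negbTE.
Qed.

Lemma separated_antipode (x y : G) :
  y \in \bigcap_(C in theta_classes G) opp_semicube C x ->
  unique (relative_antipode x) y.
Proof.
move=> xy; have dS := dist_sym connG; split.
  (* As [y] is in [semicube y z], [x] is in [semicube z y]: stepping off [y] approaches [x]. *)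
  move=> z yz; have := theta_separated_edge xy yz.
  have := yz; rewrite edge_dist // !inE dist_xx (dS z) !(dS _ x).
  by move=> /eqP ->; lia.
move=> z xz; apply/eqP/negPn/negP; rewrite eq_sym => zy.
(* Any other [z] has a neighbor closer to [y], hence farther from [x]. *)
have [w zw wy] := closer_neighbor connG zy.
have wz : w -- z by rewrite sg_sym.
have := theta_separated_edge xy wz.
by rewrite !inE wy ltnNge !(dS _ x) xz.
Qed.

End PartialCube.

(** * From isomorphic opposite semicubes to antipodality *)

Lemma isomorphic_card (G H : sgraph) : isomorphic G H -> #|G| = #|H|.
Proof. by move=> [f [bij_f _]]; apply: bij_eq_card bij_f. Qed.

Section IsomorphicAntipodal.
Variables (G : sgraph) (connG : connected G) (pcG : partial_cube G)
  (isoG : opposite_semicube_isomorphic G).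

Lemma opp_semicube_card (C : {set G * G}) (x : G) : C \in theta_classes G ->
  #|opp_semicube C x|.*2 = #|G|.
Proof.
move=> CG; have [u [v [uvC uv _ ->]]] := opp_semicube_theta_class connG pcG x CG.
have := isomorphic_card (isoG CG uvC); rewrite !card_sig /=.
have := cardsC (semicube u v).
by rewrite -(semicubeC connG pcG uv) -addnn => <- ->.
Qed.

Lemma opp_semicubes_meet (C D : {set G * G}) (x : G) :
  C \in theta_classes G -> D \in theta_classes G ->
  opp_semicube C x :&: opp_semicube D x != set0.
Proof.
move=> CG DG; rewrite setI_eq0 disjoints_subset.
have notin E : E \in theta_classes G -> x \notin opp_semicube E x.
  move=> /(opp_semicube_theta_class connG pcG x)[u [v [_ uv xu ->]]].
  by rewrite semicubeC // inE xu.
apply/negP => CD; have := notin _ CG.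
rewrite (_ : opp_semicube C x = ~: opp_semicube D x).
  by rewrite inE notin.
(* Disjointness gives one inclusion, and both sets contain half the vertices. *)
apply/eqP; rewrite eqEcard CD.
have := cardsC (opp_semicube D x).
have := opp_semicube_card x CG; have := opp_semicube_card x DG; lia.
Qed.

Lemma isomorphic_antipodal : opposite_semicube_Helly G -> antipodal G.
Proof.
move=> hellyG x.
have /set0Pn[y xy] := hellyG x (fun C D CG DG _ => opp_semicubes_meet x CG DG).
by exists y; apply: separated_antipode.
Qed.

End IsomorphicAntipodal.

Theorem theorem5p4 (G : sgraph) (connG : connected G) (pcG : partial_cube G)
    (hellyG : opposite_semicube_Helly G) :
  antipodal G <-> opposite_semicube_isomorphic G.
Proof.
split=> [antiG|isoG]; first exact: antipodal_isomorphic.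
exact: isomorphic_antipodal.
Qed.
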